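(* Let $E \subset \mathbb{F}_q^d$, where $d \ge 2$, and suppose that $|E| \ge \frac{4k}{\ln 2}\, q^{\frac{d+1}{2}}$. Then the distance graph of $E$ contains a non-overlapping chain of length $k$ of every type; that is, for every $\vec t = (t_1,\dots,t_k)$ with $t_i \in \mathbb{F}_q$ and $t_i \neq 0$ for $1 \le i \le k$, there exist pairwise distinct points $x^1,\dots,x^{k+1} \in E$ such that $\|x^i - x^{i+1}\| = t_i$ for all $1 \le i \le k$.
   Context: $\mathbb{F}_q$ is a finite field with $q$ elements and $\mathbb{F}_q^d$ is the $d$-dimensional vector space over it. $k \ge 1$ is an integer. For $x=(x_1,\dots,x_d) \in \mathbb{F}_q^d$, $\|x\| = x_1^2 + \dots + x_d^2 \in \mathbb{F}_q$. $|S|$ denotes the number of elements of a finite set $S$. The distance graph of $E$ has vertex set $E$, with $x,y \in E$ joined by an edge when $\|x-y\|=1$. A path (chain) of length $k$ in a graph is a sequence of vertices $v^1,\dots,v^{k+1}$ such that each pair $v^i, v^{i+1}$, $1 \le i \le k$, is connected by an edge; it is non-overlapping if all the $v^j$ are distinct. For a chain of type $(t_1,\dots,t_k)$, the edge condition on the $i$-th pair is $\|v^i - v^{i+1}\| = t_i$; paths in the distance graph itself correspond to the type $(1,\dots,1)$.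
   Formalization: The formal theorem assumes that q is odd; for even q the claim fails, e.g. for E = {x : x_1+...+x_d in H} with H an index-2 additive subgroup of F_q not containing 1, q large, and t = (1,...,1). *)

(* Defs.v *)
From HB Require Import structures.
From mathcomp Require Import all_boot all_order all_algebra.
From mathcomp Require Import reals exp.

Set Implicit Arguments.
Unset Strict Implicit.
Unset Printing Implicit Defensive.

Import GRing.Theory.
Local Open Scope ring_scope.

(* The F-valued "norm" x_1^2 + ... + x_d^2. In characteristic 2 it is the
   square of the linear form x_1 + ... + x_d, so that distances degenerate:
   the union of half of the level sets of that form can omit a prescribed
   nonzero distance. Hence the main statement takes |F| odd. *)
Definition sqnorm (F : finFieldType) (d : nat) (x : 'rV[F]_d) : F :=
  \sum_(j < d) x 0 j ^+ 2.

(* The k + 1 vertices are indexed from 0: for i : 'I_k, [widen_ord _ i] has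
   value i and [lift ord0 i] has value i + 1 in 'I_k.+1. *)
Definition chain_of_type (F : finFieldType) (d k : nat) (E : {set 'rV[F]_d})
    (t : 'I_k -> F) (x : 'I_k.+1 -> 'rV[F]_d) : Prop :=
  (forall i : 'I_k.+1, x i \in E) /\
  (forall i : 'I_k,
     sqnorm (x (widen_ord (leqnSn k) i) - x (lift ord0 i)) = t i).

Definition non_overlapping (F : finFieldType) (d k : nat)
    (x : 'I_k.+1 -> 'rV[F]_d) : Prop :=
  injective x.

(* Main.v *)
Require Import Defs.
From mathcomp Require Import all_boot all_order all_fingroup all_algebra.
From mathcomp Require Import all_field all_character.
From mathcomp Require Import reals exp.
From mathcomp Require Import ring zify.

(** The distance-t graph on F_q^d, t <> 0, is pseudo-random: for A in F_q^d the
    numbers deg_A(x) of points of A at distance t from x satisfy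
      sum_x (q deg_A(x) - |A|)^2 <= 4 q^(d+1) |A|          (1)
    so that only few x can have much fewer than |A|/q neighbours in A
    ([low_degree_bound]).

    Chains from (1).  Work backwards from A_(k+1) = E, letting A_i be the points
    of E that have at least k neighbours, at distance t_i, in A_(i+1).  If
    2|A_(i+1)| >= |E| and |E| >= 4k q^((d+1)/2), then (1) forces 2|A_i| >= |E|
    ([popular_subset_large]); no loss accumulates along the chain, and ln 2 <= 1
    makes the hypothesis strong enough.  Starting from a point of A_1 one then
    moves forward greedily: the k neighbours available at each step outnumber
    the at most k - 1 earlier vertices other than the current one, and the
    current one is not its own neighbour as t_i <> 0 ([greedy_chain]).

    Pseudo-randomness.  By Plancherel, (1) says that every Fourier coefficient
    of q 1_(|z| = t) - 1 has modulus at most 2 q^((d+1)/2).  Completing squares,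
    the coefficient at m is the sum over u <> 0 of
    g(u)^d psi(- t u - |m| / (4 u)), where g(u) is the quadratic Gauss sum, of
    modulus q^(1/2), and g(u)^2 does not depend on u ([gauss_sum_scale]).  For
    odd d this is a Salie sum, and one change of variables evaluates it
    ([gauss_kloosterman_bound]).  For even d it is a Kloosterman sum, for which
    Weil's bound |K| <= 2 q^(1/2) is needed ([kloosterman_weil]).

    Weil's bound.  If L is the quadratic extension of F, then K_L = 2q - K_F^2,
    because x + y and x y, for x, y in F, together with the trace and norm of
    z in L, take each value (s, p) exactly twice in all
    ([kloosterman_quadratic_ext]).  Hence r = |K| / q^(1/2) is replaced by
    r^2 - 2 when passing to L, and iterating makes it unbounded as soon as r > 2
    at the start.  On the other hand Stepanov's method ([stepanov_bound]) shows
    that over an extension of degree 2m >= 4 the trace of a x + b / x takes no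
    value more than q^(2m-1) + 2 q^m times, which bounds |K| by 2 q q^m + 1:
    the ratio stays below 2q + 1 all the way up. *)

Set Implicit Arguments.
Unset Strict Implicit.
Unset Printing Implicit Defensive.

Import Order.TTheory GRing.Theory Num.Theory.
Local Open Scope ring_scope.

(** * Stepanov's method *)

Lemma poly_family_dependent (L : fieldType) (I : finType) (N : nat)
    (theta : I -> {poly L}) :
  (forall i, size (theta i) <= N)%N -> (N < #|I|)%N ->
  exists2 c : I -> L, exists i, c i != 0 & \sum_i c i *: theta i = 0.
Proof.
move=> szt ltNI.
pose M := \matrix_(i < #|I|, j < N) (theta (enum_val i))`_j.
have [v vM v0]: exists2 v : 'rV[L]_#|I|, v *m M = 0 & v != 0.
  have : kermx M != 0.
    rewrite kermx_eq0 /row_free; apply/negP => /eqP rk.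
    by have := rank_leq_col M; rewrite rk leqNgt ltNI.
  by case/rowV0Pn => v /sub_kermxP vM v0; exists v.
exists (fun i => v 0 (enum_rank i)).
  have [i vi] : exists i, v 0 i != 0 by apply/rV0Pn.
  by exists (enum_val i); rewrite enum_valK.
apply/polyP => j; rewrite coef0 coef_sum.
have [ltjN|leNj] := ltnP j N; last first.
  by apply: big1 => i _; rewrite coefZ [_`_j]nth_default ?mulr0 // (leq_trans (szt i)).
transitivity ((v *m M) 0 (Ordinal ltjN)); last by rewrite vM mxE.
rewrite mxE (reindex (@enum_val I I)) /=; last exact/onW_bij/enum_val_bij.
by apply: eq_bigr => i _; rewrite coefZ enum_valK !mxE.
Qed.

(** No cancellation can occur in the largest degree that is present. *)
Lemma sum_distinct_degrees_neq0 (L : idomainType) (I : finType) (N : nat)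
    (c : I -> L) (g : I -> {poly L}) (D : I -> nat) (i0 : I) :
  injective D -> (forall i, size (g i) = (D i).+1) -> (forall i, D i < N)%N ->
  c i0 != 0 -> 
  \sum_i c i *: g i != 0 /\ (size (\sum_i c i *: g i)%R <= N)%N.
Proof.
move=> injD szg ltDN ci0; split; last first.
  apply: (leq_trans (size_sum _ _ _)); apply/bigmax_leqP => i _.
  by apply: leq_trans (size_scale_leq _ _) _; rewrite szg.
case: (arg_maxnP (P := [pred i | c i != 0]) D ci0) => /= i ci maxi.
apply/eqP => /polyP/(_ (D i)); rewrite coef0 coef_sum (bigD1 i) //= big1 ?addr0.
  move/eqP; rewrite coefZ mulf_eq0 (negPf ci) /=.
  have -> : D i = (size (g i)).-1 by rewrite szg.
  by rewrite -/(lead_coef _) lead_coef_eq0 -size_poly_eq0 szg.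
move=> j ji; rewrite coefZ; have [->|cj] := eqVneq (c j) 0; first by rewrite mul0r.
rewrite [_`_(D i)]nth_default ?mulr0 // szg ltn_neqAle (inj_eq injD) ji.
exact: maxi.
Qed.

Lemma mixed_radix_inj (s i i' m m' : nat) : (i < s)%N -> (i' < s)%N ->
  (i + s * m = i' + s * m')%N -> i = i' /\ m = m'.
Proof.
move=> lti lti' e; have s0 : (0 < s)%N by apply: leq_ltn_trans lti.
have ei : i = i'.
  have := congr1 (modn^~ s) e.
  by rewrite /= ![(s * _)%N]mulnC ![(_ + _ * s)%N]addnC !modnMDl !modn_small.
split=> //; move/eqP: e; rewrite ei eqn_add2l eqn_pmul2l // => /eqP; exact.
Qed.

(** Write Q = |L| = r^2, r = q s, and h(x) = H(x) / x^s, so that x^Q = x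
    everywhere and h^r = C - h on Z.  For any coefficients c the r-th power of
      Psi = sum c_ijk^r x^i H^j x^(s (q-1-j) + r k)   (i < s, j < q, k <= s)
    agrees on Z, up to powers of x, with
      sum c_ijk x^(i r + k) (C x^s - H)^j x^(s (q-1-j)),
    whose degree is smaller than q s (s+1) - 1 although that of Psi^r is about
    q^2 s^3.  With q s (s+1) coefficients to choose, some c <> 0 makes this sum
    vanish identically, and then Z consists of roots of Psi.  The terms of Psi
    have distinct degrees, so Psi <> 0, and its degree, about q s^2 = Q / q,
    bounds |Z|. *)
Lemma stepanov_bound (L : finFieldType) (q s : nat) (C : L) (H : {poly L})
    (Z : {set L}) :
    (#|L| = (q * s) ^ 2)%N -> (1 < s)%N -> (0 < q)%N ->
    (forall x y : L, (x + y) ^+ (q * s) = x ^+ (q * s) + y ^+ (q * s)) ->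
    size H = (2 * s).+1 -> 0 \notin Z ->
    (forall x, x \in Z ->
       (H.[x] / x ^+ s) ^+ (q * s) = C - H.[x] / x ^+ s) ->
  (#|Z| <= q * s ^ 2 + 2 * q * s)%N.
Proof.
move=> cardL s1 q0 frob szH Z0 hZ; set r := (q * s)%N in cardL frob hZ.
have r0 : (0 < r)%N by rewrite muln_gt0 q0 ltnW.
have frobS (J : finType) (f : J -> L) : (\sum_i f i) ^+ r = \sum_i f i ^+ r.
  elim/big_rec2: _ => [|i y x _ <-]; last by rewrite frob.
  by rewrite expr0n; case: (r) r0.
pose I : finType := ('I_s * 'I_q * 'I_s.+1)%type.
have H0 : H != 0 by rewrite -size_poly_eq0 szH.
(* The degrees are at most (s-1) r + s + 2 s (q-1), while there are
   q s (s+1) indices: the former is smaller because s > 1. *)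
have [//||c [i0 ci0] cdep] := @poly_family_dependent L I
   (q * s ^ 2 + q * s - s + 1)%N
   (fun i => 'X^(i.1.1 * r + i.2) * (C *: 'X^s - H) ^+ i.1.2
      * 'X^(s * (q.-1 - i.1.2))).
- move=> [[i j] k] /=.
  set G := C *: 'X^s - H.
  have szG : (size G <= (2 * s).+1)%N.
    rewrite (leq_trans (size_polyD _ _)) // geq_max size_polyN szH leqnn andbT.
    by rewrite (leq_trans (size_scale_leq _ _)) // size_polyXn; lia.
  have szGj : (size (G ^+ j) <= (j * (2 * s)).+1)%N.
    apply: (leq_trans (size_poly_exp_leq _ _)).
    by rewrite ltnS mulnC leq_mul //; clear -szG; lia.
  apply: (leq_trans (size_polyMleq _ _)); rewrite size_polyXn.
  have := size_polyMleq 'X^(i * r + k) (G ^+ j); rewrite size_polyXn.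
  move: szGj; set u := size _; set v := size _ => hu hv.
  have: (v <= i * r + k + j * (2 * s) + 1)%N by lia.
  have := ltn_ord i; have := ltn_ord j; have := ltn_ord k.
  have : (s * (q.-1 - j) + s * j = s * q.-1)%N.
    by rewrite -mulnDr subnK //; have := ltn_ord j; clear -q0; lia.
  have hi : (i.+1 * r <= s * r)%N by rewrite leq_mul2r ltn_ord orbT.
  have hj : (s * j <= s * q.-1)%N by rewrite leq_mul2l -ltnS prednK ?ltn_ord ?orbT.
  have hr : (r = s * q.-1 + s)%N by rewrite /r mulnC -mulnSr prednK.
  have -> : (q * s ^ 2 = s * r)%N by rewrite mulnCA mulnC.
  rewrite -/r; move: hi; rewrite mulSn; clear -s1 q0 hj hr; lia.
- by rewrite !card_prod !card_ord; nia.
(* The degree of the (i,j,k) term of Psi, injective as i < s, j < q. *)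
pose D (i : I) := (i.1.1 + s * i.1.2 + q * s * i.2 + s * q.-1)%N.
pose g (i : I) : {poly L} :=
  'X^(i.1.1) * H ^+ i.1.2 * 'X^(s * (q.-1 - i.1.2) + r * i.2).
have szg i : size (g i) = (D i).+1.
  case: i => [[i j] k]; rewrite /g /D /=.
  have Hj0 : H ^+ j != 0 by rewrite expf_neq0.
  rewrite size_mulXn ?mulf_neq0 // ?expf_neq0 ?polyX_eq0 // .
  rewrite mulrC size_mulXn //.
  have := size_exp H j; rewrite szH /= => szHj.
  have szHj0 : (0 < size (H ^+ j))%N by rewrite size_poly_gt0.
  rewrite -[size (H ^+ j)]prednK // szHj.
  have : (s * (q.-1 - j) + s * j = s * q.-1)%N.
    by rewrite -mulnDr subnK //; have := ltn_ord j; clear -q0; lia.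
  move: (s * (q.-1 - j))%N (s * q.-1)%N => u w <-.
  by rewrite /r; clear; lia.
have injD : injective D.
  case=> [[i j] k] [[i' j'] k']; rewrite /D /= => e.
  have [ei] : i = i' :> nat /\ (j + q * k = j' + q * k')%N.
    apply: (@mixed_radix_inj s); rewrite ?ltn_ord //; apply/eqP.
    rewrite -(eqn_add2r (s * q.-1)); apply/eqP; move: e.
    by rewrite !mulnDr !mulnA ![(s * q)%N]mulnC !addnA.
  case/(mixed_radix_inj (ltn_ord j) (ltn_ord j')) => ej ek.
  by congr (_, _, _); apply/val_inj.
have ltD i : (D i < q * s ^ 2 + 2 * q * s)%N.
  case: i => [[i j] k]; rewrite /D /=.
  have := ltn_ord i; have := ltn_ord j; have := ltn_ord k; nia.
have cr0 : c i0 ^+ r != 0 by rewrite expf_neq0.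
have [] := sum_distinct_degrees_neq0 (c := fun i => c i ^+ r) injD szg ltD cr0.
set Psi := \sum_i _ => Psi0 szPsi.
have rootPsi x : x \in Z -> root Psi x.
  move=> xZ; have x0 : x != 0 by apply: contraNneq Z0 => <-.
  have hx := hZ x xZ; set h := H.[x] / x ^+ s in hx.
  have Hx : H.[x] = h * x ^+ s by rewrite /h divfK // expf_neq0.
  have xs0 n : x ^+ n != 0 by rewrite expf_neq0.
  rewrite rootE.
  suff: Psi.[x] ^+ r * x ^+ (s * q.-1) == 0.
    by rewrite mulf_eq0 (negPf (xs0 _)) orbF expf_eq0 r0.
  apply/eqP.
  have xrr : x ^+ (r * r) = x by rewrite -[(r * r)%N]/(r ^ 2)%N -cardL expf_card.
  suff -> : Psi.[x] ^+ r * x ^+ (s * q.-1)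
     = x ^+ (s * q.-1 * r) * (\sum_i c i *: ('X^(i.1.1 * r + i.2)
          * (C *: 'X^s - H) ^+ i.1.2 * 'X^(s * (q.-1 - i.1.2)))).[x].
    by rewrite cdep horner0 mulr0.
  rewrite !horner_sum frobS mulr_suml mulr_sumr; apply: eq_bigr => -[[i j] k] _.
  set cc := c _; rewrite /g /= 2!hornerZ !hornerM !hornerXn !horner_exp.
  rewrite hornerD hornerN hornerZ hornerXn.
  have ccr : (cc ^+ r) ^+ r = cc.
    by rewrite -exprM -[(r * r)%N]/(r ^ 2)%N -cardL expf_card.
  have jq : (j <= q.-1)%N by rewrite -ltnS prednK.
  have -> : (s * q.-1 = s * j + s * (q.-1 - j))%N by rewrite -mulnDr subnKC.
  have Hj : (H.[x] ^+ j) ^+ r = (C - h) ^+ j * x ^+ (s * j * r).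
    rewrite -exprM mulnC exprM Hx exprMn hx exprMn -!exprM.
    by rewrite (mulnC r) mulnA.
  have -> : (C * x ^+ s - H.[x]) ^+ j = (C - h) ^+ j * x ^+ (s * j).
    by rewrite Hx -mulrBl exprMn -exprM.
  have xk : x ^+ (r * k) ^+ r = x ^+ k by rewrite -exprM mulnAC exprM xrr.
  rewrite !exprMn ccr Hj !exprD exprMn xk mulnDl !exprD !exprM.
  by ring.
rewrite cardE; apply: leq_trans szPsi; apply: ltnW.
apply: max_poly_roots => //; last exact: enum_uniq.
by apply/allP => x; rewrite mem_enum; apply: rootPsi.
Qed.

(** * Additive characters and Frobenius *)

Definition additive_char (V : zmodType) (phi : V -> algC) : Prop :=
  {morph phi : x y / x + y >-> x * y} /\ forall x, `|phi x| = 1.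

Section AddChar.
Variables (V : zmodType) (phi : V -> algC).
Hypothesis phiP : additive_char phi.

Lemma additive_charD x y : phi (x + y) = phi x * phi y.
Proof. by case: phiP. Qed.

Lemma additive_char_norm x : `|phi x| = 1.
Proof. by case: phiP. Qed.

Lemma additive_char_neq0 x : phi x != 0.
Proof. by rewrite -normr_eq0 additive_char_norm oner_neq0. Qed.

Lemma additive_char0 : phi 0 = 1.
Proof.
by apply: (mulfI (additive_char_neq0 0)); rewrite -additive_charD addr0 mulr1.
Qed.

Lemma additive_charN x : phi (- x) = (phi x)^*.
Proof.
apply: (mulfI (additive_char_neq0 x)).
by rewrite -additive_charD subrr additive_char0 -normCK additive_char_norm expr1n.
Qed.

Lemma additive_char_sum (I : Type) (r : seq I) (P : pred I) (F : I -> V) :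
  phi (\sum_(i <- r | P i) F i) = \prod_(i <- r | P i) phi (F i).
Proof. exact: (big_morph phi additive_charD additive_char0). Qed.

End AddChar.

Lemma additive_char_comp (V W : zmodType) (phi : V -> algC) (f : W -> V) :
  additive_char phi -> {morph f : x y / x + y} -> additive_char (phi \o f).
Proof. by move=> [pD pN] fD; split=> [x y|x] /=; rewrite ?fD ?pD. Qed.

Lemma sum_nontrivial_additive_char (V : finZmodType) (phi : V -> algC) (x0 : V) :
  additive_char phi -> phi x0 != 1 -> \sum_x phi x = 0.
Proof.
move=> phiP phix0; set S := \sum_x _.
have : S * (phi x0 - 1) = 0.
  apply/eqP; rewrite mulrBr mulr1 subr_eq0; apply/eqP.
  rewrite {2}/S (reindex_inj (addIr x0)) /= mulr_suml.
  by apply: eq_bigr => x _; rewrite additive_charD.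
by move/eqP; rewrite mulf_eq0 subr_eq0 (negPf phix0) orbF => /eqP.
Qed.

Lemma sum_additive_char_mul (F : finFieldType) (phi : F -> algC) (x0 c : F) :
  additive_char phi -> phi x0 != 1 ->
  \sum_x phi (x * c) = if c == 0 then #|F|%:R else 0.
Proof.
move=> phiP phix0; have [->|c0] := eqVneq.
  under eq_bigr do rewrite mulr0 (additive_char0 phiP).
  by rewrite sumr_const.
rewrite -(reindex_inj (mulIf c0) (F := phi) (P := xpredT)) /=.
exact: sum_nontrivial_additive_char phix0.
Qed.

(** An abelian group has as many linear characters as elements. *)
Lemma nontrivial_additive_char_exists (F : finFieldType) :
  exists phi : F -> algC, additive_char phi /\ exists x0, phi x0 != 1.
Proof.
pose G : {group F} := [set: F]%G.
have abG : abelian G by apply/centsP => x _ y _; apply: addrC.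
have lin := char_abelianP _ abG.
have N1 : (1 < Nirr G)%N.
  rewrite NirrE; move: abG; rewrite card_classes_abelian => /eqP ->.
  by rewrite cardsT finNzRing_gt1.
pose i : Iirr G := Ordinal N1.
have i0 : i != 0 by [].
exists 'chi_i; split.
  split=> [x y|x]; first by rewrite -lin_charM ?inE.
  by rewrite normC_lin_char ?inE.
case: (pickP [pred x | 'chi_i x != 1]) => [x /= hx|h1]; first by exists x.
case/eqP: i0; apply: irr_inj; rewrite irr0; apply/cfunP => x.
by rewrite cfun1E inE; have /= /negbFE/eqP := h1 x.
Qed.

Lemma card_finField_pchar_nat (K : finFieldType) (p : nat) :
  p \in [pchar K] -> p.-nat #|K|.
Proof.
by move=> hp; rewrite -cardsT; exact: (pprimeChar_pgroup hp).
Qed.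

Lemma odd_card_two_neq0 (F : finFieldType) : odd #|F| -> (2 : F) != 0.
Proof.
move=> oddq; apply/negP => two0.
have p2 : 2%N \in [pchar F] by rewrite inE.
have := card_finField_pchar_nat p2.
case: #|F| (finNzRing_gt1 F) oddq => // n n1 odn /(pnat_dvd (pdiv_dvd _)).
rewrite pnatE ?pdiv_prime // inE => /eqP e.
by have := dvdn_odd (pdiv_dvd n.+1) odn; rewrite e.
Qed.

Section FrobeniusExt.
Variables (F L : finFieldType) (iota : {rmorphism F -> L}).
Local Notation q := #|F|.

Lemma frobeniusD i (x y : L) : (x + y) ^+ (q ^ i) = x ^+ (q ^ i) + y ^+ (q ^ i).
Proof.
apply: exprDn_pchar; rewrite pnatX; apply/orP; left.
have [p _ hp] := finPcharP F.
rewrite (eq_pnat _ (fmorph_pchar iota)) (eq_pnat _ (pcharf_eq hp)).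
exact: card_finField_pchar_nat.
Qed.

Lemma frobenius_fixed (z : L) : z ^+ q = z -> exists c, z = iota c.
Proof.
move=> hz; have := congr1 (fun p => (map_poly iota p).[z]) (finField_genPoly F).
rewrite /= rmorphB rmorph_prod /= map_polyXn map_polyX horner_prod !hornerE hz subrr.
move/esym/eqP; rewrite prodf_seq_eq0 => /hasP[c _] /=.
by rewrite map_polyXsubC hornerXsubC subr_eq0 => /eqP ->; exists c.
Qed.

Lemma embedding_frobenius c i : iota c ^+ (q ^ i) = iota c.
Proof.
elim: i => [|i IH]; first by rewrite expr1.
by rewrite expnSr exprM IH -rmorphXn expf_card.
Qed.

Lemma frobenius_trace n (x : L) : #|L| = (q ^ n)%N ->
  exists c, \sum_(i < n) x ^+ (q ^ i) = iota c.
Proof.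
move=> cardL; apply: frobenius_fixed.
case: n cardL => [|n] cardL.
  by rewrite big_ord0 expr0n; case: (q) (finNzRing_gt1 F).
have frobS m (f : 'I_m -> L) : (\sum_i f i) ^+ q = \sum_i f i ^+ q.
  elim/big_rec2: _ => [|i y z _ <-]; last by have := frobeniusD 1 (f i) z; rewrite expn1.
  by rewrite expr0n; case: (q) (finNzRing_gt1 F).
rewrite frobS big_ord_recr [RHS]big_ord_recl /= expn0 expr1 addrC; congr (_ + _).
  by rewrite -exprM -expnSr -cardL expf_card.
by apply: eq_bigr => i _; rewrite -exprM -expnSr.
Qed.

End FrobeniusExt.

(** * Kloosterman sums over an extension field *)

Definition kloosterman (F : finFieldType) (phi : F -> algC) (a b : F) : algC :=
  \sum_(x | x != 0) phi (a * x + b / x).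

Lemma kloosterman_real (F : finFieldType) (phi : F -> algC) (a b : F) :
  additive_char phi -> kloosterman phi a b \is Num.real.
Proof.
move=> phiP; apply/CrealP; rewrite rmorph_sum /= /kloosterman.
rewrite [RHS](reindex_inj oppr_inj) /=; apply: eq_big => [x|x _].
  by rewrite oppr_eq0.
by rewrite -additive_charN // opprD mulrN invrN mulrN.
Qed.

(** With Q = q^(2m) and f(x) = a x + b / x, the trace splits as h + h^(q^m),
    where h is the sum of f^(q^i) over i < m; its poles at 0 and at infinity
    have order s = q^(m-1) only.  Taking H = x^s h, Stepanov's method applies to
    the x of trace c.  Here m = n + 2, which ensures s > 1. *)
Lemma trace_fiber_bound (F L : finFieldType) (iota : {rmorphism F -> L})
    (n : nat) (a b c : F) (s := (#|F| ^ n.+1)%N) :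
  #|L| = (#|F| ^ n.+2.*2)%N -> a != 0 ->
  (#|[set x : L | (x != 0) &&
      (\sum_(i < n.+2.*2) (iota a * x + iota b / x) ^+ (#|F| ^ i) == iota c)]%R|
    <= #|F| * s ^ 2 + 2 * #|F| * s)%N.
Proof.
set q := #|F|; set A := iota a; set B := iota b => cardL a0.
have q1 : (1 < q)%N := finNzRing_gt1 F.
have s1 : (1 < s)%N by rewrite /s -[X in (X < _)%N](exp1n n.+1) ltn_exp2r.
have A0 : A != 0 by rewrite fmorph_eq0.
have rE : (q * s = q ^ n.+2)%N by rewrite /s -expnS.
pose f x := A * x + B / x.
pose H : {poly L} :=
  \sum_(i < n.+2) (A *: 'X^(s + q ^ i) + B *: 'X^(s - q ^ i)).
have szX (e : L) k : (size (e *: 'X^k) <= k.+1)%N.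
  by rewrite (leq_trans (size_scale_leq _ _)) ?size_polyXn.
have szH : size H = (2 * s).+1.
  rewrite /H big_ord_recr /= -/s subnn addnn -mul2n addrCA.
  rewrite size_polyDl size_scale // size_polyXn //.
  rewrite ltnS (leq_trans (size_polyD _ _)) // geq_max; apply/andP; split.
    apply: (leq_trans (size_sum _ _ _)); apply/bigmax_leqP => i _ /=.
    have lti : (q ^ i < s)%N by rewrite /s ltn_exp2l //.
    apply: (leq_trans (size_polyD _ _)); rewrite geq_max; apply/andP; split.
      by apply: leq_trans (szX _ _) _; clear -lti; lia.
    by apply: leq_trans (szX _ _) _; clear -s1 lti; lia.
  by apply: leq_trans (szX _ _) _; clear -s1; lia.
have HE x : x != 0 -> H.[x] / x ^+ s = \sum_(i < n.+2) f x ^+ (q ^ i).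
  move=> x0; rewrite /H horner_sum mulr_suml; apply: eq_bigr => i _.
  rewrite !hornerE -/q frobeniusD // !exprMn !embedding_frobenius.
  have lei : (q ^ i <= s)%N by rewrite /s leq_exp2l // -ltnS.
  rewrite mulrDl addnC exprD mulrA mulfK ?expf_neq0 //; congr (_ + _).
  rewrite -mulrA; congr (_ * _).
  by rewrite expfB_cond ?(negPf x0) // mulrAC divff ?expf_neq0 // mul1r exprVn.
apply: (@stepanov_bound L q s (iota c) H) => //.
- by rewrite cardL rE -expnM; congr expn; clear; lia.
- exact: ltnW.
- by move=> x y; rewrite rE; apply: frobeniusD.
- by rewrite inE eqxx.
move=> x; rewrite inE => /andP[x0 /eqP trx]; rewrite HE //.
rewrite -trx -/(f x).
have -> : n.+2.*2 = (n.+2 + n.+2)%N by rewrite addnn.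
rewrite big_split_ord /= addrAC subrr add0r rE.
have frobS m (g : 'I_m -> L) : (\sum_i g i) ^+ (q ^ n.+2) = \sum_i g i ^+ (q ^ n.+2).
  elim/big_rec2: _ => [|i y z _ <-]; last exact: frobeniusD.
  by rewrite expr0n -rE muln_eq0; case: (q) (s) q1 s1 => [|?] [].
by rewrite frobS; apply: eq_bigr => i _; rewrite -exprM -expnD addnC.
Qed.

(** Upper bounds M for all the fibres of the trace suffice: the fibre sizes have
    a known sum, hence so have their defects from M, while the constant M itself
    contributes 0 because psi sums to 0. *)
Lemma kloosterman_trace_bound (F L : finFieldType) (iota : {rmorphism F -> L})
    (psi : F -> algC) (phi : L -> algC) (n : nat) (a b : F) (x0 : F) :
  #|L| = (#|F| ^ n.+2.*2)%N -> a != 0 ->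
  additive_char psi -> psi x0 != 1 ->
  (forall x c, iota c = \sum_(i < n.+2.*2) x ^+ (#|F| ^ i) -> phi x = psi c) ->
  `|kloosterman phi (iota a) (iota b)| <= (2 * #|F| * #|F| ^ n.+2 + 1)%:R.
Proof.
move=> cardL a0 psiP px0 phiE; set q := #|F|; set s := (q ^ n.+1)%N.
pose Z c := [set x : L | (x != 0) &&
      (\sum_(i < n.+2.*2) (iota a * x + iota b / x) ^+ (q ^ i) == iota c)].
pose M := (q * s ^ 2 + 2 * q * s)%N.
have leZ c : (#|Z c| <= M)%N by apply: trace_fiber_bound.
have KE : kloosterman phi (iota a) (iota b) = \sum_c psi c * #|Z c|%:R.
  rewrite /kloosterman.
  transitivity (\sum_(x : L | x != 0) \sum_(c | x \in Z c) psi c).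
    apply: eq_bigr => x x0'.
    have [c hc] := frobenius_trace iota (iota a * x + iota b / x) cardL.
    rewrite (big_pred1 c) => [|c']; first exact: phiE.
    by rewrite inE x0' hc /= (inj_eq (fmorph_inj iota)) eq_sym.
  rewrite (exchange_big_dep xpredT) //=; apply: eq_bigr => c _.
  rewrite mulr_natr -sumr_const; apply: eq_bigl => x.
  by rewrite inE; case: (x != 0).
have sumZ : (\sum_c #|Z c| = #|L|.-1)%N.
  rewrite -(cardC1 (0 : L)) -sum1_card.
  transitivity (\sum_c \sum_(x in Z c) 1)%N.
    by apply: eq_bigr => c _; rewrite sum1_card.
  rewrite (exchange_big_dep (fun x => x != 0)) /=; last first.
    by move=> c x _; rewrite inE => /andP[].
  apply: eq_bigr => x x0'.
  have [c hc] := frobenius_trace iota (iota a * x + iota b / x) cardL.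
  rewrite (big_pred1 c) // => c'.
  by rewrite inE x0' hc /= (inj_eq (fmorph_inj iota)) eq_sym.
have psi0 : \sum_c psi c = 0 by apply: sum_nontrivial_additive_char px0.
have -> : kloosterman phi (iota a) (iota b)
    = - \sum_c psi c * (M - #|Z c|)%:R.
  rewrite KE -sumrN; apply/eqP; rewrite -subr_eq0 -sumrB.
  under eq_bigr => c _ do rewrite opprK -mulrDr -natrD subnKC ?leZ //.
  by rewrite -mulr_suml psi0 mul0r.
rewrite normrN (le_trans (ler_norm_sum _ _ _)) //.
under eq_bigr => c _ do rewrite normrM (additive_char_norm psiP) mul1r normr_nat.
rewrite -natr_sum ler_nat sumnB // sum_nat_const sumZ cardL.
have -> : (q ^ n.+2 = q * s)%N by rewrite expnS.
have -> : (q ^ n.+2.*2 = (q * s) ^ 2)%N.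
  by rewrite /s -expnS -expnM; congr expn; clear; lia.
rewrite -/q /M; clear; nia.
Qed.

(** * The Kloosterman sum of a quadratic extension *)

Lemma quadratic_ext_exists (F : finFieldType) : odd #|F| ->
  exists (L : finFieldType) (iota : {rmorphism F -> L}), #|L| = (#|F| ^ 2)%N.
Proof.
move=> oddq.
have [g hg] : exists g : F, forall x, x ^+ 2 != g.
  case: (pickP [pred g : F | [forall x, x ^+ 2 != g]]) => [g /= /forallP hg|h].
    by exists g.
  have inj : injective (fun x : F => x ^+ 2).
    apply/injectiveP; apply: (@leq_size_uniq _ (enum F));
      rewrite ?enum_uniq ?size_map //.
    move=> g _; have /negbT := h g; rewrite /= negb_forall => /existsP[x].
    by rewrite negbK => /eqP <-; apply: map_f; rewrite mem_enum.
  have : (1 : F) = -1 by apply: inj; rewrite /= sqrrN.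
  move/eqP; rewrite -addr_eq0 -[1 + 1]/(2 : F).
  by rewrite (negPf (odd_card_two_neq0 oddq)).
pose h : {poly F} := 'X^2 - g%:P.
have szh : size h = 3 by rewrite /h size_XnsubC.
have hI : monic_irreducible_poly h.
  split; last first.
    rewrite monicE lead_coefDl ?lead_coefXn // size_polyN size_polyXn.
    exact: leq_ltn_trans (size_polyC_leq1 _) _.
  apply: cubic_irreducible; first by rewrite szh.
  by move=> x; rewrite /h rootE !hornerE subr_eq0 hg.
exists {poly %/ h with hI}, (GRing.in_alg {poly %/ h with hI}).
by rewrite card_qfpoly szh.
Qed.

Lemma sum_fibers (I J : finType) (g : I -> J) (Q : pred J) (f : J -> algC) :
  \sum_(x | Q (g x)) f (g x) = \sum_(y | Q y) #|[set x | g x == y]|%:R * f y.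
Proof.
rewrite (partition_big g Q) //; apply: eq_bigr => y Qy.
rewrite mulr_natl -sumr_const; apply: eq_big => [x|x /andP[_ /eqP -> //]].
by rewrite inE andb_idl // => /eqP ->.
Qed.

Lemma sum_card_fibers (I J : finType) (g : I -> J) :
  (\sum_y #|[set x | g x == y]| = #|I|)%N.
Proof.
rewrite -sum1_card (partition_big g xpredT) //=; apply: eq_bigr => y _.
by rewrite -sum1_card; apply: eq_bigl => x; rewrite inE.
Qed.

Section QuadraticExt.
Variables (F L : finFieldType) (iota : {rmorphism F -> L}).
Local Notation q := #|F|.
Hypothesis cardL : #|L| = (q ^ 2)%N.

Definition rel_inv (z : L) : F := odflt 0 [pick c | iota c == z].

Lemma rel_invK z : z ^+ q = z -> iota (rel_inv z) = z.
Proof.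
case/(frobenius_fixed iota) => c ->; rewrite /rel_inv; case: pickP => [d /eqP //|].
by move/(_ c); rewrite eqxx.
Qed.

Lemma frobenius_square_id (z : L) : (z ^+ q) ^+ q = z.
Proof. by rewrite -exprM -[(q * q)%N]/(q ^ 2)%N -cardL expf_card. Qed.

Definition rel_trace (z : L) : F := rel_inv (z + z ^+ q).
Definition rel_norm (z : L) : F := rel_inv (z * z ^+ q).

Lemma rel_traceE z : iota (rel_trace z) = z + z ^+ q.
Proof.
apply: rel_invK; have := frobeniusD iota 1 z (z ^+ q).
by rewrite expn1 => ->; rewrite frobenius_square_id addrC.
Qed.

Lemma rel_normE z : iota (rel_norm z) = z * z ^+ q.
Proof. by apply: rel_invK; rewrite exprMn frobenius_square_id mulrC. Qed.

Definition split_pairs (u : F * F) :=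
  [set v : F * F | (v.1 + v.2, v.1 * v.2) == u].
Definition inert_points (u : F * F) := [set z : L | (rel_trace z, rel_norm z) == u].

(** The pairs and points counted are roots of X^2 - s X + p.  If this polynomial
    has a root in F, then its roots in L are x and y, which have trace 2x and 2y,
    so that an element of L counts only if x = y, in which case there is only
    one pair. *)
Lemma split_inert_le2 u : (#|split_pairs u| + #|inert_points u| <= 2)%N.
Proof.
have [P0|[[x y]]] := set_0Vmem (split_pairs u).
  rewrite P0 cards0 add0n cardE.
  pose p : {poly L} := 'X^2 - iota u.1 *: 'X + (iota u.2)%:P.
  have szp : size p = 3.
    rewrite /p -addrA size_polyDl size_polyXn //.
    rewrite (leq_ltn_trans (size_polyD _ _)) // gtn_max.
    rewrite (leq_ltn_trans (size_polyC_leq1 _)) // andbT size_polyN.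
    by rewrite (leq_ltn_trans (size_scale_leq _ _)) // size_polyX.
  suff: (size (enum (inert_points u)) < size p)%N by rewrite szp.
  apply: max_poly_roots; rewrite ?enum_uniq //.
    by rewrite -size_poly_eq0 szp.
  apply/allP => z; rewrite mem_enum inE => /eqP uE.
  by rewrite rootE /p -uE !hornerE rel_traceE rel_normE; apply/eqP; ring.
rewrite inE /= => /eqP uE.
have Nxy z : z \in inert_points u -> z = iota x /\ x = y.
  rewrite inE -uE => /eqP[/(congr1 iota) + /(congr1 iota)].
  rewrite rel_traceE rel_normE rmorphD rmorphM /= => ht hn.
  have : (z - iota x) * (z - iota y) == 0.
    have -> : (z - iota x) * (z - iota y)
      = z * z - (iota x + iota y) * z + iota x * iota y by ring.
    by rewrite -ht -hn; apply/eqP; ring.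
  have zz w : z = iota w -> z ^+ q = z.
    by move=> ->; have := embedding_frobenius iota w 1; rewrite expn1.
  rewrite mulf_eq0 !subr_eq0 => /orP[/eqP|/eqP] zE;
    move: ht; rewrite (zz _ zE) zE.
    by move/addrI/fmorph_inj.
  by move/addIr/fmorph_inj => ->.
have Pxy v : v \in split_pairs u -> v = (x, y) \/ v = (y, x).
  case: v => v w; rewrite inE -uE => /eqP[/= hs hp].
  have : (v - x) * (v - y) == 0.
    have -> : (v - x) * (v - y) = v * v - (x + y) * v + x * y by ring.
    by rewrite -hs -hp; apply/eqP; ring.
  rewrite mulf_eq0 !subr_eq0 => /orP[/eqP|/eqP] e; move: hs; rewrite e.
    by move/addrI ->; left.
  by rewrite addrC => /addIr ->; right.
have [xy|xy] := eqVneq x y.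
  have P1 : (#|split_pairs u| <= 1)%N.
    rewrite -(cards1 (x, y)); apply/subset_leq_card/subsetP => v /Pxy.
    by rewrite inE xy => -[] ->.
  have N1 : (#|inert_points u| <= 1)%N.
    rewrite -(cards1 (iota x)); apply/subset_leq_card/subsetP => v /Nxy[-> _].
    by rewrite inE.
  exact: (leq_add P1 N1).
have -> : inert_points u = set0.
  by apply/setP => z; rewrite in_set0; apply/negP => /Nxy[_ /eqP]; apply/negP.
rewrite cards0 addn0 (leq_trans (n := #|[set (x, y); (y, x)]|)) //.
  apply/subset_leq_card/subsetP => v /Pxy.
  by rewrite !inE => -[] ->; rewrite eqxx ?orbT.
by rewrite cards2 ltnS leq_b1.
Qed.

(** The bound 2 is attained everywhere since it is attained on average: there
    are q^2 pairs, q^2 elements of L, and q^2 values of u. *)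
Lemma split_inert_eq2 u : (#|split_pairs u| + #|inert_points u| = 2)%N.
Proof.
apply/eqP; move: u; apply/forallP.
have [_ <-] := leqif_sum (I := (F * F)%type) (P := xpredT)
  (fun u _ => conj (split_inert_le2 u) (erefl _)).
rewrite big_split /= !sum_card_fibers card_prod cardL sum_nat_const card_prod.
by apply/eqP; rewrite muln2 -addnn.
Qed.

(** Both K_F^2 and K_L are sums of psi(a s + b s / p) over (s, p), p <> 0, with
    weights that add up to 2; summing over s leaves only p = - b / a. *)
Lemma kloosterman_quadratic_ext (psi : F -> algC) (phi : L -> algC)
    (x0 a b : F) :
  additive_char psi -> psi x0 != 1 -> a != 0 -> b != 0 ->
  (forall z c, iota c = z + z ^+ q -> phi z = psi c) ->
  kloosterman phi (iota a) (iota b) = (2 * q)%:R - kloosterman psi a b ^+ 2.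
Proof.
move=> psiP px0 a0 b0 phiE.
pose f (u : F * F) := psi (a * u.1 + b * (u.1 / u.2)).
have KL : kloosterman phi (iota a) (iota b)
    = \sum_(u : F * F | u.2 != 0) #|inert_points u|%:R * f u.
  rewrite -(sum_fibers (fun z => (rel_trace z, rel_norm z))
                       (fun u => u.2 != 0)) /=.
  have nm0 z : (rel_norm z != 0) = (z != 0).
    rewrite -(fmorph_eq0 iota) rel_normE mulf_eq0 expf_eq0.
    by case: (z == 0); rewrite //= andbF.
  apply: eq_big => [z|z z0]; first by rewrite nm0.
  apply: phiE; rewrite rmorphD !rmorphM fmorphV /= rel_traceE rel_normE.
  have zq0 : z ^+ q != 0 by rewrite expf_neq0.
  have -> : (iota a * z + iota b / z) ^+ q = iota a * z ^+ q + iota b / z ^+ q.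
    have := frobeniusD iota 1 (iota a * z) (iota b / z).
    rewrite expn1 => ->; rewrite !exprMn exprVn.
    have := embedding_frobenius iota a 1.
    by have := embedding_frobenius iota b 1; rewrite expn1 => -> ->.
  by field; rewrite z0 zq0.
have KF : kloosterman psi a b ^+ 2
    = \sum_(u : F * F | u.2 != 0) #|split_pairs u|%:R * f u.
  rewrite -(sum_fibers (fun v : F * F => (v.1 + v.2, v.1 * v.2))
                       (fun u => u.2 != 0)) /=.
  rewrite expr2 /kloosterman big_distrlr /= pair_big /=.
  apply: eq_big => [[x y]|[x y] /= /andP[x1 y1]].
    by rewrite /= mulf_eq0 negb_or.
  rewrite -(additive_charD psiP) /f /=; congr psi.
  by field; rewrite x1 y1.
apply/eqP; rewrite -subr_eq0 opprB addrA subr_eq0 KL KF -big_split /=.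
apply/eqP; transitivity (\sum_(u : F * F | u.2 != 0) 2 * f u).
  apply: eq_bigr => u _; rewrite -mulrDl -natrD addnC split_inert_eq2 //.
rewrite -mulr_sumr natrM; congr (_ * _).
transitivity (\sum_(p : F | p != 0) \sum_(s : F) psi (s * (a + b / p))).
  rewrite exchange_big /= pair_big_dep /=; apply: eq_big => [[s p] //|[s p] /= _].
  by rewrite /f /=; congr psi; ring.
under eq_bigr => p _ do rewrite (sum_additive_char_mul _ psiP px0).
rewrite -big_mkcondr (big_pred1 (- b / a)) // => p /=.
have [->|p0] := eqVneq p 0.
  by rewrite /= [RHS]eq_sym mulf_eq0 oppr_eq0 invr_eq0 (negPf a0) (negPf b0).
rewrite /= -(inj_eq (mulIf p0)) mul0r mulrDl divfK // addr_eq0.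
by rewrite -(inj_eq (mulIf a0) p) divfK // mulrC.
Qed.

End QuadraticExt.

(** * Weil's bound for Kloosterman sums *)

(** If k is a Kloosterman sum over the field with q elements, this is the
    corresponding sum over its extension of degree 2^j. *)
Fixpoint kloosterman_tower (q : nat) (k : algC) (j : nat) : algC :=
  if j is j'.+1 then (2 * q ^ 2 ^ j')%:R - kloosterman_tower q k j' ^+ 2 else k.

(** The character over L is psi composed with successive quadratic traces.  Their
    composition is recorded as a single sum of powers because this is the form
    of the trace to which Stepanov's method applies. *)
Lemma kloosterman_towerP (F : finFieldType) (psi : F -> algC) (x0 a b : F)
    (j : nat) :
  odd #|F| -> additive_char psi -> psi x0 != 1 -> a != 0 -> b != 0 ->
  exists (L : finFieldType) (iota : {rmorphism F -> L}) (phi : L -> algC),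
  [/\ #|L| = (#|F| ^ 2 ^ j)%N, additive_char phi, exists y0, phi y0 != 1,
    forall x c, iota c = \sum_(i < 2 ^ j) x ^+ (#|F| ^ i) -> phi x = psi c
  & kloosterman phi (iota a) (iota b)
      = kloosterman_tower #|F| (kloosterman psi a b) j].
Proof.
move=> oddq psiP px0 a0 b0; set q := #|F|.
elim: j => [|j [L [iota [phi [cardL phiP [y0 py0] phiE KE]]]]].
  exists F, (idfun : {rmorphism F -> F}), psi; split => //.
  - by exists x0.
  - by move=> x c; rewrite big_ord1 expr1 => hc; congr psi; apply: esym hc.
have oddL : odd #|L| by rewrite cardL oddX oddq orbT.
have [M [kappa cardM]] := quadratic_ext_exists oddL.
pose phi' z := phi (rel_trace kappa z).
pose iota' : {rmorphism F -> M} := kappa \o iota.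
exists M, iota', phi'.
have cardM' : #|M| = (q ^ 2 ^ j.+1)%N.
  by rewrite cardM cardL -expnM expnSr.
split=> //.
- apply: (additive_char_comp phiP) => x y; apply: (fmorph_inj kappa).
  rewrite rmorphD !rel_traceE //; have := frobeniusD kappa 1 x y.
  by rewrite expn1 => ->; rewrite addrACA.
- exists (kappa (y0 / 2)); rewrite /phi'.
  suff -> : rel_trace kappa (kappa (y0 / 2)) = y0 by [].
  apply: (fmorph_inj kappa); rewrite rel_traceE //.
  have := embedding_frobenius kappa (y0 / 2) 1; rewrite expn1 => ->.
  rewrite -rmorphD; congr (kappa _).
  by field; apply: odd_card_two_neq0.
- move=> x c hc; apply: phiE; apply: (fmorph_inj kappa).
  rewrite [LHS]hc rmorph_sum /= expnS mul2n -addnn big_split_ord /=.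
  rewrite -big_split /=.
  apply: eq_bigr => i _; rewrite rmorphXn rel_traceE //= cardL.
  have -> := frobeniusD iota' i x (x ^+ (q ^ 2 ^ j)).
  by rewrite -exprM -expnD.
rewrite /= (kloosterman_quadratic_ext cardM phiP py0) ?fmorph_eq0 //.
  by rewrite KE cardL.
move=> z c hc; congr phi; apply: (fmorph_inj kappa); rewrite rel_traceE //.
Qed.

(** In terms of r_j = |K_j| / q^(2^(j-1)) the recursion is r_(j+1) = r_j^2 - 2,
    whose fixed point 2 is repelling: (2 + e)^2 - 2 >= 2 + 4 e. *)
Lemma kloosterman_tower_growth (q : nat) (k : algC) (j : nat) :
  (0 < q)%N -> k \is Num.real -> 4 * q%:R < k ^+ 2 ->
  (2 + 4 ^+ j * (k ^+ 2 / q%:R - 4)) * (q ^ 2 ^ j)%:R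
    <= - kloosterman_tower q k j.+1.
Proof.
move=> q0 kR k4; set d := _ - 4.
have q0' : 0 < q%:R :> algC by rewrite ltr0n.
have d0 : 0 < d by rewrite subr_gt0 ltr_pdivlMr.
elim: j => [|j IH].
  rewrite /= expr0 expn0 expn1 mul1r opprB /d natrM le_eqVlt; apply/orP; left; apply/eqP.
  by field; rewrite gt_eqF.
rewrite [kloosterman_tower _ _ _.+2]/= -/(kloosterman_tower q k j.+1) opprB.
set y := kloosterman_tower q k j.+1 in IH *.
set Q := (q ^ 2 ^ j)%:R in IH.
have Q0 : 0 <= Q by rewrite ler0n.
have -> : (q ^ 2 ^ j.+1)%:R = Q ^+ 2 by rewrite expnSr expnM natrX.
rewrite natrM (_ : (q ^ 2 ^ j.+1)%:R = Q ^+ 2); last by rewrite expnSr expnM natrX.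
set e := 4 ^+ j * d in IH.
have e0 : 0 <= e by rewrite mulr_ge0 ?exprn_ge0 // ltW.
have -> : 4 ^+ j.+1 * d = 4 * e by rewrite exprS mulrA.
have lhs0 : 0 <= (2 + e) * Q by rewrite mulr_ge0 // addr_ge0.
rewrite -(sqrrN y) lerBrDr.
apply: le_trans (_ : ((2 + e) * Q) ^+ 2 <= _); last first.
  by rewrite !expr2 ler_pM.
rewrite -subr_ge0.
have -> : ((2 + e) * Q) ^+ 2 - ((2 + 4 * e) * Q ^+ 2 + 2 * Q ^+ 2) = (e * Q) ^+ 2 by ring.
by rewrite exprn_ge0 // mulr_ge0.
Qed.

Theorem kloosterman_weil (F : finFieldType) (psi : F -> algC) (x0 a b : F) :
  odd #|F| -> additive_char psi -> psi x0 != 1 -> a != 0 -> b != 0 ->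
  kloosterman psi a b ^+ 2 <= 4 * #|F|%:R.
Proof.
move=> oddq psiP px0 a0 b0; set k := kloosterman _ _ _; set q := #|F|.
have kR : k \is Num.real by apply: kloosterman_real.
have q1 : (1 < q)%N := finNzRing_gt1 F.
rewrite real_leNgt ?realX ?realM ?realn //; apply/negP => k4.
have q0' : 0 < q%:R :> algC by rewrite ltr0n ltnW.
set d := k ^+ 2 / q%:R - 4.
have d0 : 0 < d by rewrite subr_gt0 ltr_pdivlMr.
(* Beyond this level of the tower the growth exceeds Stepanov's bound. *)
have [j j0 hj] : exists2 j, (0 < j)%N & 2 * q%:R < 4 ^+ j * d.
  pose N := Num.bound (2 * q%:R / d).
  exists N.+1 => //; rewrite -ltr_pdivrMr //.
  have := archi_boundP (x := 2 * q%:R / d) _; rewrite -/N.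
  move=> /(_ _)/lt_le_trans; apply.
    by rewrite divr_ge0 ?mulr_ge0 // ltW.
  rewrite -natrX ler_nat (leq_trans (leqnSn _)) // ltnW //.
  exact: ltn_expl.
have [L [iota [phi [cardL phiP _ phiE KE]]]] :=
  kloosterman_towerP j.+1 oddq psiP px0 a0 b0.
have [n hn] : exists n, (2 ^ j = n.+2)%N.
  have : (1 < 2 ^ j)%N by rewrite -[X in (X < _)%N](expn0 2) ltn_exp2l.
  by case: (2 ^ j)%N => [|[|n]] // _; exists n.
have hn2 : (2 ^ j.+1 = n.+2.*2)%N by rewrite expnS hn mul2n.
rewrite hn2 in cardL phiE.
have := kloosterman_trace_bound b cardL a0 psiP px0 phiE.
rewrite KE => bnd.
have grow := kloosterman_tower_growth j (ltnW q1) kR k4.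
have : (2 + 4 ^+ j * d) * (q ^ 2 ^ j)%:R <= (2 * q * q ^ n.+2 + 1)%:R.
  apply: (le_trans grow); apply: le_trans bnd.
  rewrite -normrN real_ler_norm // ger0_real // (le_trans _ grow) //.
  by rewrite mulr_ge0 // addr_ge0 // mulr_ge0 ?exprn_ge0 // ltW.
rewrite hn; set Q := (q ^ n.+2)%N; apply/negP; rewrite lt_geF //.
have Q1 : (1 <= Q)%N by rewrite expn_gt0 ltnW.
rewrite natrD natrM (natrM _ 2) [ltRHS]mulrDl [ltRHS]addrC; apply: ltr_leD.
  by rewrite ltr_pM2r // ltr0n.
by rewrite -natrM ler_nat (leq_trans Q1) // leq_pmull.
Qed.

(** * Quadratic Gauss sums *)

Definition gauss_sum (F : finFieldType) (psi : F -> algC) (u : F) : algC :=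
  \sum_z psi (u * z ^+ 2).

Lemma card_scaled_sqrt_le2 (F : finFieldType) (a b : F) :
  a != 0 -> (#|[set z | (a * z ^+ 2 == b)%R]| <= 2)%N.
Proof.
move=> a0; have [->|[y]] := set_0Vmem [set z | (a * z ^+ 2 == b)%R].
  by rewrite cards0.
rewrite inE => /eqP <-; rewrite (leq_trans (n := #|[set y; - y]|)) //.
  apply/subset_leq_card/subsetP => z.
  by rewrite !inE (inj_eq (mulfI a0)) eqf_sqr.
by rewrite cards2 ltnS leq_b1.
Qed.

(** For v = 0 both sets are {0}.  For v <> 0 they cannot both be nonempty, as a
    quotient of their elements would exhibit u as a square; so the sum is at
    most 2, and it is 2 on average over v. *)
Lemma card_sqrt_nonsquare (F : finFieldType) (u v : F) :
  (forall z, z ^+ 2 != u) ->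
  (#|[set z | (z ^+ 2 == v)%R]| + #|[set z | (u * z ^+ 2 == v)%R]| = 2)%N.
Proof.
move=> nsq; have u0 : u != 0.
  by apply: contraNneq (nsq 0) => ->; rewrite expr0n.
have le2 w : (#|[set z | (z ^+ 2 == w)%R]| + #|[set z | (u * z ^+ 2 == w)%R]| <= 2)%N.
  have le2' : (#|[set z | (z ^+ 2 == w)%R]| <= 2)%N.
    rewrite (leq_trans _ (card_scaled_sqrt_le2 w (oner_neq0 F))) //.
    by apply/subset_leq_card/subsetP => z; rewrite !inE mul1r.
  have [->|w0] := eqVneq w 0.
    rewrite (_ : [set z | _] = [set 0]); last first.
      by apply/setP => z; rewrite !inE expf_eq0.
    rewrite (_ : [set z | _] = [set 0]) ?cards1 //.
    by apply/setP => z; rewrite !inE mulf_eq0 (negPf u0) expf_eq0.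
  have [->|[y]] := set_0Vmem [set z | (z ^+ 2 == w)%R].
    by rewrite cards0 card_scaled_sqrt_le2.
  rewrite inE => /eqP yw; rewrite [X in (_ + X)%N](_ : _ = 0%N) ?addn0 //.
  apply/eqP; rewrite cards_eq0; apply/eqP/setP => z; rewrite !inE -yw.
  apply/negP => /eqP uz; have z0 : z != 0.
    by apply: contraNneq w0 => z0; rewrite -yw -uz z0 expr0n mulr0.
  by have /negP := nsq (y / z); apply; rewrite expr_div_n -uz mulfK // expf_neq0.
apply/eqP; move: v; apply/forallP.
have [_ <-] := leqif_sum (I := F) (P := xpredT) (fun w _ => conj (le2 w) (erefl _)).
by rewrite big_split /= !sum_card_fibers sum_nat_const muln2 addnn.
Qed.

Section GaussSums.
Variables (F : finFieldType) (psi : F -> algC) (x0 : F).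
Hypotheses (oddq : odd #|F|) (psiP : additive_char psi) (px0 : psi x0 != 1).
Local Notation q := #|F|.
Local Notation g := (gauss_sum psi).

Lemma sum_char_nonzero (c : F) :
  \sum_(x | x != 0) psi (x * c) = (if c == 0 then q%:R else 0) - 1.
Proof.
rewrite -(sum_additive_char_mul c psiP px0) [X in _ = X - 1](bigD1 0) //=.
by rewrite mul0r (additive_char0 psiP) addrAC subrr add0r.
Qed.

(** The factor e is the quadratic character of l.  When l is not a square,
    g(l w) + g(w) runs twice over the values of a nontrivial character. *)
Lemma gauss_sum_scale (l : F) : l != 0 ->
  exists2 e : algC, e ^+ 2 = 1 & forall w, w != 0 -> g (l * w) = e * g w.
Proof.
move=> l0; case: (pickP [pred z | z ^+ 2 == l]) => [z /eqP zl|nsq].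
  exists 1 => [|w w0]; first by rewrite expr1n.
  have z0 : z != 0 by apply: contraNneq l0 => z0; rewrite -zl z0 expr0n.
  rewrite mul1r /gauss_sum [RHS](reindex_inj (mulfI z0)) /=.
  by apply: eq_bigr => y _; rewrite exprMn zl; congr psi; ring.
exists (-1) => [|w w0]; first by rewrite sqrrN expr1n.
apply/eqP; rewrite mulN1r -addr_eq0 /gauss_sum; apply/eqP.
pose f v := psi (v * w).
rewrite (eq_bigr (fun z => f (l * z ^+ 2))) => [|z _]; last by rewrite /f mulrAC.
rewrite [X in _ + X](eq_bigr (fun z => f (z ^+ 2))) => [|z _]; last by rewrite /f mulrC.
rewrite (sum_fibers (fun z => l * z ^+ 2) xpredT) (sum_fibers (fun z => z ^+ 2) xpredT).
rewrite -big_split /= (eq_bigr (fun v => 2 * f v)) => [|v _]; last first.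
  by rewrite -mulrDl -natrD addnC card_sqrt_nonsquare // => z; have /negbT := nsq z.
by rewrite -mulr_sumr (sum_additive_char_mul _ psiP px0) (negPf w0) mulr0.
Qed.

Lemma gauss_sum_norm (u : F) : u != 0 -> `|g u| ^+ 2 = q%:R.
Proof.
move=> u0; rewrite normCK rmorph_sum /= /gauss_sum big_distrlr /=.
transitivity (\sum_y \sum_s psi (u * s ^+ 2) * psi (y * (2 * u * s))).
  rewrite exchange_big /=; apply: eq_bigr => y _.
  rewrite (reindex_inj (addIr y)) /=; apply: eq_bigr => s _.
  rewrite -(additive_charN psiP) -!(additive_charD psiP); congr psi; ring.
rewrite exchange_big /=; under eq_bigr => s _.
  rewrite -mulr_sumr (sum_additive_char_mul _ psiP px0) mulf_eq0 mulf_eq0.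
  rewrite (negPf u0) (negPf (odd_card_two_neq0 oddq)) /=; over.
rewrite (bigD1 0) //= eqxx big1 ?addr0 => [|s /negPf ->]; last by rewrite mulr0.
by rewrite expr0n mulr0 (additive_char0 psiP) mul1r.
Qed.

Lemma gauss_sum_inv (u : F) : u != 0 -> g u^-1 = g u.
Proof.
move=> u0; rewrite /gauss_sum (reindex_inj (mulfI u0)) /=.
by apply: eq_bigr => z _; rewrite exprMn expr2 !mulrA mulVf // mul1r.
Qed.

(** Evaluation of the Salie sum.  Up to a sign g(u) = g(1/u) is g(- a / u), and
    shifting z by u in the latter turns - a z^2 / u into
    - a z^2 / u - 2 a z - a u.  This cancels the term a u, so the sum over u
    becomes one over 1/u of psi((b - a z^2) / u), which detects a z^2 = b: at
    most two values of z. *)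
Lemma gauss_kloosterman_bound (a b : F) : a != 0 ->
  `|\sum_(u | u != 0) g u * psi (a * u + b / u)| <= 2 * q%:R.
Proof.
move=> a0; have Na0 : - a != 0 by rewrite oppr_eq0.
have [e e2 ge] := gauss_sum_scale Na0.
have e1 : `|e| = 1.
  by apply/eqP; rewrite -[_ == _](@eqrXn2 _ 2) // ?expr1n -?normrX ?e2 ?normr1.
rewrite -[leLHS]mul1r -[X in X * `|_| <= _]e1 -normrM mulr_sumr.
have -> : \sum_(u | u != 0) e * (g u * psi (a * u + b / u))
    = \sum_z psi (- (2 * a * z)) * \sum_(u | u != 0) psi (u * (b - a * z ^+ 2)).
  under [RHS]eq_bigr => z _ do rewrite (reindex_inj invr_inj) /= mulr_sumr.
  under [RHS]eq_bigr => z _.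
    rewrite (eq_bigl (fun u => u != 0)); last by move=> u; rewrite invr_eq0.
    over.
  rewrite [RHS]exchange_big /=; apply: eq_bigr => u u0.
  rewrite -gauss_sum_inv // mulrA -ge ?invr_eq0 // mulr_suml.
  rewrite (reindex_inj (addIr u)) /=; apply: eq_bigr => z _.
  by rewrite -!(additive_charD psiP); congr psi; field.
under eq_bigr => z _ do rewrite sum_char_nonzero mulrBr mulr1.
rewrite sumrB (_ : \sum_z psi (- (2 * a * z)) = 0) ?subr0; last first.
  under eq_bigr => z _ do rewrite -mulNr mulrC.
  rewrite (sum_additive_char_mul _ psiP px0) oppr_eq0 mulf_eq0 (negPf a0).
  by rewrite (negPf (odd_card_two_neq0 oddq)).
rewrite (le_trans (ler_norm_sum _ _ _)) //.
rewrite (eq_bigr (fun z => if a * z ^+ 2 == b then q%:R else 0)) => [|z _].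
  rewrite -big_mkcond /= sumr_const -[leLHS]mulr_natl ler_pM2r ?ltr0n; last first.
    exact: ltnW (finNzRing_gt1 F).
  rewrite ler_nat (leq_trans _ (card_scaled_sqrt_le2 b a0)) //.
  by apply/subset_leq_card/subsetP => z; rewrite inE.
rewrite normrM (additive_char_norm psiP) mul1r subr_eq0 eq_sym.
by case: eqP; rewrite ?normr_nat ?normr0.
Qed.

(** As g(u)^2 is constant, only the parity of d matters: the sum reduces to a
    Kloosterman sum for even d and to a Salie sum for odd d.  For d even and
    b = 0 it is a sum over a nontrivial character with one term left out. *)
Lemma gauss_power_sum_bound (d : nat) (a b : F) : a != 0 ->
  `|\sum_(u | u != 0) g u ^+ d * psi (a * u + b / u)| ^+ 2 <= (4 * q ^ d.+1)%:R.
Proof.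
move=> a0; have q1 := finNzRing_gt1 F.
have g2 u : u != 0 -> g u ^+ 2 = g 1 ^+ 2.
  move=> u0; have [e e2 ge] := gauss_sum_scale u0.
  by rewrite -[u]mulr1 ge ?oner_neq0 // exprMn e2 mul1r.
have gn : `|g 1| ^+ 2 = q%:R by rewrite gauss_sum_norm ?oner_neq0.
have := odd_double_half d; set h := d./2; case: (odd d) => /= <-.
  rewrite -mul2n.
  under eq_bigr => u u0 do rewrite exprS exprM g2 // [_ * (_ ^+ _)]mulrC -mulrA.
  rewrite -mulr_sumr normrM exprMn 2!normrX gn.
  have -> : (4 * q ^ (1 + 2 * h).+1 = (q ^ h) ^ 2 * (2 * q) ^ 2)%N.
    by rewrite -expnM expnMn mulnCA -expnD; congr (_ * q ^ _)%N; clear; lia.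
  rewrite natrM !natrX natrM ler_wpM2l ?exprn_ge0 ?ler0n //.
  by rewrite ler_pXn2r ?nnegrE ?mulr_ge0 ?gauss_kloosterman_bound.
under eq_bigr => u u0 do rewrite add0n -mul2n exprM g2 //.
rewrite -mulr_sumr normrM exprMn 2!normrX gn add0n.
have -> : (4 * q ^ h.*2.+1 = (q ^ h) ^ 2 * (4 * q))%N.
  by rewrite -expnM mulnCA -expnSr; congr (_ * q ^ _)%N; clear; lia.
rewrite natrM !natrX natrM ler_wpM2l ?exprn_ge0 ?ler0n //.
rewrite -/(kloosterman psi a b); have [->|b0] := eqVneq b 0; last first.
  rewrite real_normK ?kloosterman_real //.
  exact: kloosterman_weil px0 _ _.
rewrite /kloosterman; under eq_bigr => u _ do rewrite mul0r addr0 mulrC.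
rewrite sum_char_nonzero (negPf a0) sub0r normrN1 expr1n -natrM ler1n.
by rewrite muln_gt0; apply: ltnW.
Qed.
End GaussSums.

(** * Fourier analysis of the sphere *)

Definition dotp (F : finFieldType) (d : nat) (m x : 'rV[F]_d) : F :=
  \sum_(j < d) m 0 j * x 0 j.

Lemma sum_row_prod (F : finFieldType) (d : nat) (G : 'I_d -> F -> algC) :
  \sum_(z : 'rV[F]_d) \prod_j G j (z 0 j) = \prod_j \sum_x G j x.
Proof.
rewrite bigA_distr_bigA /=.
rewrite (reindex (fun f : {ffun 'I_d -> F} => \row_j f j)) /=.
  by apply: eq_bigr => f _; apply: eq_bigr => j _; rewrite mxE.
exists (fun z : 'rV[F]_d => [ffun j => z 0 j]) => [f _|z _].
  by apply/ffunP => j; rewrite ffunE mxE.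
by apply/rowP => j; rewrite mxE ffunE.
Qed.

Section Fourier.
Variables (F : finFieldType) (psi : F -> algC) (x0 : F) (d : nat).
Hypotheses (psiP : additive_char psi) (px0 : psi x0 != 1).
Local Notation q := #|F|.
Local Notation V := 'rV[F]_d.

Definition fourier (f : V -> algC) (m : V) : algC :=
  \sum_x f x * psi (dotp m x).

Lemma dotpDr (m x y : V) : dotp m (x + y) = dotp m x + dotp m y.
Proof.
by rewrite /dotp -big_split; apply: eq_bigr => j _; rewrite mxE mulrDr.
Qed.

Lemma dotpBr (m x y : V) : dotp m (x - y) = dotp m x - dotp m y.
Proof.
by rewrite /dotp -sumrB; apply: eq_bigr => j _; rewrite !mxE mulrBr.
Qed.

Lemma fourier_orthogonality (x : V) :
  \sum_m psi (dotp m x) = if x == 0 then (q ^ d)%:R else 0.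
Proof.
transitivity (\prod_(j < d) \sum_(c : F) psi (c * x 0 j)).
  rewrite -sum_row_prod; apply: eq_bigr => m _.
  by rewrite (additive_char_sum psiP).
under eq_bigr => j _ do rewrite (sum_additive_char_mul _ psiP px0).
have [->|/rV0Pn[j xj]] := eqVneq x 0.
  under eq_bigr => j _ do rewrite mxE eqxx.
  by rewrite prodr_const card_ord natrX.
by rewrite (bigD1 j) //= (negPf xj) mul0r.
Qed.

Lemma fourier_parseval (f : V -> algC) :
  \sum_m `|fourier f m| ^+ 2 = (q ^ d)%:R * \sum_x `|f x| ^+ 2.
Proof.
transitivity (\sum_x \sum_y f x * (f y)^* * \sum_m psi (dotp m (x - y))).
  under eq_bigr => m _ do rewrite normCK rmorph_sum big_distrlr /=.
  rewrite exchange_big; apply: eq_bigr => x _; rewrite exchange_big.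
  apply: eq_bigr => y _; rewrite mulr_sumr; apply: eq_bigr => m _.
  by rewrite rmorphM /= mulrACA -(additive_charN psiP) -(additive_charD psiP) -dotpBr.
rewrite mulr_sumr; apply: eq_bigr => x _.
rewrite (bigD1 x) //= [X in _ + X]big1 ?addr0 => [|y yx].
  by rewrite fourier_orthogonality subrr eqxx mulrC -normCK.
by rewrite fourier_orthogonality subr_eq0 eq_sym (negPf yx) mulr0.
Qed.

Lemma fourier_convolution (f k : V -> algC) (m : V) :
  fourier (fun x => \sum_y f y * k (x - y)) m = fourier k m * fourier f m.
Proof.
rewrite /fourier mulrC big_distrlr /=.
under eq_bigr => x _ do rewrite mulr_suml.
rewrite exchange_big; apply: eq_bigr => y _.
rewrite (reindex_inj (addIr y)) /=; apply: eq_bigr => z _.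
by rewrite addrK dotpDr (additive_charD psiP); ring.
Qed.

Lemma convolution_l2_bound (f k : V -> algC) (B : algC) :
  (forall m, `|fourier k m| ^+ 2 <= B) ->
  \sum_x `|\sum_y f y * k (x - y)| ^+ 2 <= B * \sum_x `|f x| ^+ 2.
Proof.
move=> hB; have q0 : 0 < (q ^ d)%:R :> algC.
  by rewrite ltr0n expn_gt0 ltnW // finNzRing_gt1.
rewrite -(ler_pM2l q0) -fourier_parseval mulrCA -fourier_parseval mulr_sumr.
apply: ler_sum => m _; rewrite fourier_convolution normrM exprMn.
by rewrite ler_wpM2r ?exprn_ge0.
Qed.

(** The indicator of the sphere, scaled by q, minus its expected value; the
    subtraction removes the frequency u = 0 from its expansion in characters. *)
Definition sphere_kernel (t : F) (z : V) : algC :=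
  q%:R * (sqnorm z == t)%:R - 1.

Hypothesis oddq : odd #|F|.

Lemma sum_quadratic_phase (u m : F) : u != 0 ->
  \sum_x psi (u * x ^+ 2 + m * x) = gauss_sum psi u * psi (- (m ^+ 2 / 4 / u)).
Proof.
move=> u0; have two0 := odd_card_two_neq0 oddq.
have four0 : (4 : F) != 0 by rewrite (_ : 4 = 2 * 2) ?mulf_neq0 // -natrM.
(* Completing the square. *)
rewrite (reindex_inj (addIr (- (m / 2 / u)))) /= mulr_suml.
apply: eq_bigr => x _; rewrite -(additive_charD psiP); congr psi.
by field; rewrite four0 u0 two0.
Qed.

Lemma fourier_sphere_kernel (t : F) (m : V) :
  fourier (sphere_kernel t) m =
  \sum_(u | u != 0) gauss_sum psi u ^+ d
     * psi (- t * u + - (sqnorm m / 4) / u).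
Proof.
transitivity (\sum_(z : V) \sum_(u | u != 0)
    psi (- t * u) * psi (\sum_j (u * z 0 j ^+ 2 + m 0 j * z 0 j))).
  apply: eq_bigr => z _.
  under [RHS]eq_bigr => u _ do
    rewrite big_split /= -mulr_sumr (additive_charD psiP) mulrA -(additive_charD psiP).
  rewrite -mulr_suml; congr (_ * _).
  rewrite /sphere_kernel.
  have -> : q%:R * (sqnorm z == t)%:R = \sum_u psi (u * (sqnorm z - t)).
    rewrite (sum_additive_char_mul _ psiP px0) subr_eq0.
    by case: eqP; rewrite ?mulr1 ?mulr0.
  rewrite (bigD1 0) //= mul0r (additive_char0 psiP) addrAC subrr add0r.
  apply: eq_bigr => u _; congr psi; rewrite -/(sqnorm z); ring.
rewrite exchange_big /=; apply: eq_bigr => u u0.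
rewrite -mulr_sumr; under eq_bigr => z _ do rewrite (additive_char_sum psiP).
rewrite (sum_row_prod (fun j x => psi (u * x ^+ 2 + m 0 j * x))).
under eq_bigr => j _ do rewrite sum_quadratic_phase //.
rewrite big_split /= prodr_const card_ord -(additive_char_sum psiP).
rewrite mulrCA (additive_charD psiP); congr (_ * (_ * psi _)).
by rewrite sumrN -!mulr_suml mulNr.
Qed.

Lemma sphere_kernel_l2_bound (t : F) (f : V -> algC) : t != 0 ->
  \sum_x `|\sum_y f y * sphere_kernel t (x - y)| ^+ 2
    <= (4 * q ^ d.+1)%:R * \sum_x `|f x| ^+ 2.
Proof.
move=> t0; apply: convolution_l2_bound => m; rewrite fourier_sphere_kernel.
by apply: (gauss_power_sum_bound oddq psiP px0); rewrite oppr_eq0.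
Qed.

End Fourier.

Definition sphere_degree (F : finFieldType) (d : nat) (t : F)
    (A : {set 'rV[F]_d}) (x : 'rV[F]_d) : nat :=
  #|[set y in A | sqnorm (x - y) == t]|.

(** When |A| > q k, each point of B contributes at least (|A| - q k)^2 to the sum
    of (q deg_A(x) - |A|)^2 over all x; otherwise the truncated difference
    is 0. *)
Lemma low_degree_bound (F : finFieldType) (d : nat) (t : F)
    (A B : {set 'rV[F]_d}) (k : nat) : odd #|F| -> t != 0 ->
  (forall x, x \in B -> (sphere_degree t A x <= k)%N) ->
  (#|B| * (#|A| - #|F| * k) ^ 2 <= 4 * #|F| ^ d.+1 * #|A|)%N.
Proof.
move=> oddq t0 hB; have [psi [psiP [x0 px0]]] := nontrivial_additive_char_exists F.
have := sphere_kernel_l2_bound psiP px0 oddq (fun x => (x \in A)%:R) t0.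
have -> : \sum_(x : 'rV[F]_d) `|(x \in A)%:R : algC| ^+ 2 = #|A|%:R.
  rewrite -sum1_card natr_sum [RHS]big_mkcond /=; apply: eq_bigr => x _.
  by case: (x \in A); rewrite ?normr1 ?normr0 ?expr1n ?expr0n.
have conv x : \sum_y (y \in A)%:R * sphere_kernel t (x - y)
    = #|F|%:R * (sphere_degree t A x)%:R - #|A|%:R.
  rewrite /sphere_degree -sum1_card -[#|A|]sum1_card !natr_sum mulr_sumr.
  rewrite [X in X - _]big_mkcond [X in _ - X]big_mkcond -sumrB.
  apply: eq_bigr => y _; rewrite inE /sphere_kernel.
  by case: (y \in A); case: eqP => _ /=;
    rewrite ?mul1r ?mul0r ?mulr1 ?mulr0 ?subr0.
move=> bnd; rewrite -(ler_nat algC) [leRHS]natrM; apply: le_trans bnd.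
rewrite (bigID (mem B)) /= -[leLHS]addr0 lerD //; last first.
  by apply: sumr_ge0 => x _; rewrite exprn_ge0.
rewrite natrM -sum1_card natr_sum mulr_suml; apply: ler_sum => x /hB degx.
rewrite mul1r conv natrX -[X in X <= _]real_normK ?realn //.
rewrite ler_pXn2r ?nnegrE // distrC normr_nat.
rewrite -natrM; have [le|lt] := leqP #|A| (#|F| * k).
  by move: le; rewrite -subn_eq0 => /eqP ->; apply: normr_ge0.
have le : (#|F| * sphere_degree t A x <= #|F| * k)%N by rewrite leq_mul2l degx orbT.
rewrite -natrB ?(leq_trans le (ltnW lt)) // normr_nat ler_nat.
by apply: leq_sub2l.
Qed.

(** * Greedy construction of chains *)

(** The incompatibility of [low_degree_bound] with both sets containing half of
    E; [al], [be], [n] are the sizes of A, B, E, while D = q^(d+1) and m = k - 1.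
    From (al - q m)^2 >= al (al - 2 q m) one gets n (n - 4 q m) < 16 D, whereas
    n >= 4 (m + 1) q gives n - 4 q m >= n / (m + 1). *)
Lemma large_low_degree_absurd (al be n q D m : nat) :
  (q ^ 2 <= D)%N -> (0 < q)%N -> (16 * m.+1 ^ 2 * D <= n ^ 2)%N ->
  (n <= 2 * al)%N -> (n < 2 * be)%N ->
  (be * (al - q * m) ^ 2 <= 4 * D * al)%N -> False.
Proof.
move=> qD q0 hn ha hb hab.
have D0 : (0 < D)%N by apply: leq_trans qD; rewrite expn_gt0 q0.
have h1 : (4 * m.+1 * q <= n)%N.
  rewrite -leq_sqr (leq_trans _ hn) // expnMn expnMn.
  by rewrite leq_mul2l qD orbT.
have [g gE] : exists g, al = (2 * q * m + g)%N.
  exists (al - 2 * q * m)%N; rewrite subnKC //; clear -h1 ha; nia.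
have [v vE] : exists v, n = (4 * q * m + v)%N.
  exists (n - 4 * q * m)%N; rewrite subnKC //; clear -h1; nia.
have v4 : (4 * q <= v)%N by clear -h1 vE; nia.
have gv : (v <= 2 * g)%N by clear -gE vE ha; lia.
have al0 : (0 < al)%N by clear -gE gv v4 q0; lia.
have h2 : (g * al <= (al - q * m) ^ 2)%N.
  have -> : (al - q * m = q * m + g)%N by rewrite gE; clear; nia.
  by rewrite gE; clear; nia.
have h3 : (be * g <= 4 * D)%N.
  rewrite -(leq_pmul2r al0) (leq_trans _ hab) // -mulnA.
  by rewrite leq_mul2l h2 orbT.
have h4 : (n * v < 16 * D)%N.
  have : (n * v < (2 * be) * (2 * g))%N.
    apply: (@leq_trans (2 * be * v)%N); last by rewrite leq_mul2l gv orbT.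
    by rewrite ltn_pmul2r //; clear -v4 q0; lia.
  clear -h3; lia.
have h5 : (n <= m.+1 * v)%N by rewrite vE; clear -v4; nia.
have h6 : (n ^ 2 <= m.+1 * (n * v))%N.
  by rewrite mulnCA -mulnn leq_mul2l h5 orbT.
have : (m.+1 * (n * v) < m.+1 * (16 * D))%N by rewrite ltn_pmul2l.
have : (m.+1 * (16 * D) <= 16 * m.+1 ^ 2 * D)%N.
  by rewrite mulnCA -mulnA leq_mul2l leq_mul2r /= leq_pmulr ?orbT.
move: (m.+1 * (16 * D))%N (m.+1 * (n * v))%N (16 * m.+1 ^ 2 * D)%N hn h6.
by clear; lia.
Qed.

Lemma popular_subset_large (F : finFieldType) (d k : nat) (t : F)
    (E A : {set 'rV[F]_d}) :
  odd #|F| -> t != 0 -> (0 < d)%N -> (0 < k)%N ->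
  (16 * k ^ 2 * #|F| ^ d.+1 <= #|E| ^ 2)%N -> (#|E| <= 2 * #|A|)%N ->
  (#|E| <= 2 * #|[set x in E | (k <= sphere_degree t A x)%N]|)%N.
Proof.
case: k => // m oddq t0 d0 _ hE hA; set P := [set x in E | _].
rewrite leqNgt; apply/negP => ltP.
have low x : x \in E :\: P -> (sphere_degree t A x <= m)%N.
  by rewrite !inE => /andP[+ xE]; rewrite xE /= -leqNgt.
apply: (large_low_degree_absurd _ _ hE hA _ (low_degree_bound oddq t0 low)).
- by rewrite leq_pexp2l // ltnW // finNzRing_gt1.
- exact: ltnW (finNzRing_gt1 F).
- have sPE : P \subset E by apply/subsetP => x; rewrite inE => /andP[].
  by have := cardsD E P; rewrite (setIidPr sPE); have := subset_leq_card sPE; lia.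
Qed.

(** The points of E from which a chain can be continued greedily by j more
    steps; they serve as the candidates for the vertex of index k - j, whose
    next edge has length T (k - j). *)
Fixpoint chain_targets (F : finFieldType) (d k : nat) (E : {set 'rV[F]_d})
    (T : nat -> F) (j : nat) : {set 'rV[F]_d} :=
  if j is j'.+1 then
    [set x in E | (k <= sphere_degree (T (k - j)%N) (chain_targets k E T j') x)%N]
  else E.

Lemma chain_targets_sub (F : finFieldType) (d k : nat) (E : {set 'rV[F]_d})
    (T : nat -> F) (j : nat) : chain_targets k E T j \subset E.
Proof. by case: j => //= j; apply/subsetP => x; rewrite inE => /andP[]. Qed.

(** Chains are sequences on nat here, injective up to the current index, so that
    a chain can be prolonged without changing its type. *)
Lemma greedy_chain (F : finFieldType) (d k : nat) (E : {set 'rV[F]_d})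
    (T : nat -> F) (x0 : 'rV[F]_d) (i : nat) :
  (forall j, T j != 0) -> x0 \in chain_targets k E T k -> (i <= k)%N ->
  exists x : nat -> 'rV[F]_d,
    [/\ forall j, (j <= i)%N -> x j \in chain_targets k E T (k - j),
        forall j, (j < i)%N -> sqnorm (x j - x j.+1) = T j
      & {in [pred j | (j <= i)%N] &, injective x}].
Proof.
move=> T0 x0k; elim: i => [_|i IH lik].
  exists (fun=> x0); split => // [j|j l].
    by rewrite leqn0 => /eqP ->; rewrite subn0.
  by rewrite !inE !leqn0 => /eqP -> /eqP ->.
have [x [xT xE xI]] := IH (ltnW lik).
have := xT i (leqnn i); have -> : (k - i = (k - i.+1).+1)%N by rewrite subnSK.
rewrite inE -subSn // subSS subKn; last exact: ltnW.
move=> /andP[_]; rewrite /sphere_degree; set N := [set y in _ | _] => cardN.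
(* The current vertex x i is left out: sqnorm 0 = 0 <> T i excludes it. *)
pose U := [set x (val j) | j in 'I_i].
have [y yN yU] : exists2 y, y \in N & y \notin U.
  apply/subsetPn; apply/negP => /subset_leq_card leNU.
  have := leq_imset_card (fun j : 'I_i => x j) 'I_i.
  rewrite card_ord -/U => leU.
  by have := leq_trans cardN (leq_trans leNU leU); rewrite leqNgt lik.
move: yN; rewrite inE => /andP[yT /eqP xy].
have yx j : (j <= i)%N -> x j <> y.
  rewrite leq_eqVlt => /predU1P[-> xiy|ltji xjy].
    have /eqP := T0 i; apply; rewrite -xy xiy subrr /sqnorm.
    by apply: big1 => j' _; rewrite mxE expr0n.
  by have /negP := yU; apply; apply/imsetP; exists (Ordinal ltji).
exists (fun j => if (j <= i)%N then x j else y); split=> [j|j|j l].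
- case: (leqP j i) => [leji _|ltij leji]; first exact: xT.
  by have -> : j = i.+1 by apply/eqP; rewrite eqn_leq leji.
- rewrite ltnS => leji; rewrite leji; case: (ltnP j i) => [/xE //|leij].
  by have -> : j = i by apply/eqP; rewrite eqn_leq leji.
rewrite !inE; have [leji _|ltij leji] := leqP j i; have [leli _|ltil leli] := leqP l i.
- exact: xI.
- by move/yx; case/(_ leji).
- by move/esym/yx; case/(_ leli).
- by move=> _; apply/eqP; rewrite eqn_leq (leq_trans leji ltil) (leq_trans leli ltij).
Qed.

Lemma size_hypothesis_nat (R : realType) (q d k n : nat) :
  ((4 * k)%:R / ln 2 * q%:R `^ ((d + 1)%:R / 2) <= n%:R :> R) ->
  (16 * k ^ 2 * q ^ d.+1 <= n ^ 2)%N.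
Proof.
move=> hn; set P : R := q%:R `^ ((d + 1)%:R / 2) in hn.
have P0 : 0 <= P by apply: powR_ge0.
have P2 : P ^+ 2 = (q ^ d.+1)%:R.
  rewrite -powR_mulrn // -powRrM divfK ?pnatr_eq0 //.
  by rewrite powR_mulrn ?ler0n // addn1 natrX.
have ln20 : 0 < ln (2 : R) by apply: ln_gt0; rewrite ltr1n.
have ln21 : ln (2 : R) <= 1.
  by apply: (@le_ln1Dx R 1); rewrite (lt_trans (ltrN10 R)) ?ltr01.
have k4 : (4 * k)%:R * P <= n%:R.
  apply: le_trans hn; rewrite ler_wpM2r // ler_pdivlMr //.
  by rewrite ler_piMr ?ler0n.
rewrite -(ler_nat R) natrM -P2 (natrX _ n).
have -> : (16 * k ^ 2)%:R * P ^+ 2 = ((4 * k)%:R * P) ^+ 2 :> R.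
  by rewrite exprMn -natrX expnMn.
by rewrite ler_pXn2r // ?nnegrE ?mulr_ge0 // ler0n.
Qed.

Theorem corollary1p3 (R : realType) (F : finFieldType) (d k : nat)
    (E : {set 'rV[F]_d})
    (hF : odd #|F|) (hd : (2 <= d)%N) (hk : (1 <= k)%N)
    (hE : (4 * k)%:R / ln 2 * #|F|%:R `^ ((d + 1)%:R / 2) <= #|E|%:R :> R) :
  forall t : 'I_k -> F, (forall i : 'I_k, t i != 0) ->
  exists x : 'I_k.+1 -> 'rV[F]_d,
    chain_of_type E t x /\ non_overlapping x.
Proof.
case: k hk hE => // k _ /size_hypothesis_nat hE t t0.
pose T j := t (inord j).
have T0 j : T j != 0 by apply: t0.
have big j : (#|E| <= 2 * #|chain_targets k.+1 E T j|)%N.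
  elim: j => [|j IH] /=; first by rewrite leq_pmull.
  by apply: popular_subset_large => //; apply: ltnW.
have E0 : (0 < #|E|)%N.
  rewrite -(ltn_exp2r _ _ (e := 2)) // (leq_trans _ hE) //.
  by rewrite !muln_gt0 /= !expn_gt0 ltnW // finNzRing_gt1.
have [x0 x0P] : exists x0, x0 \in chain_targets k.+1 E T k.+1.
  apply/set0Pn; rewrite -card_gt0; have := big k.+1.
  case: #|chain_targets _ _ _ _| => //; rewrite muln0 leqn0 => /eqP e.
  by rewrite e in E0.
have [x [xT xE xI]] := greedy_chain T0 x0P (leqnn _).
exists (fun i => x (val i)); split; last first.
  by move=> i j /xI e; apply/val_inj/e; rewrite inE -ltnS ltn_ord.
split=> i.
  apply: (subsetP (chain_targets_sub k.+1 E T (k.+1 - i))).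
  by apply: xT; rewrite -ltnS ltn_ord.
have := xE i (ltn_ord i); rewrite /T inord_val /= => <-.
by rewrite /bump.
Qed.
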